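(* Let $n$ be a nonnegative integer and let $K\subset\mathbb{R}^n$ be a solid order cone that is a polyhedron. Let $X\subset\mathbb{R}^n$ be a nonempty set whose interior $\operatorname{int}X$ is connected and dense in $X$. Let $T\colon X\to X$ be an injective continuous map that is monotone for the $K$-order. If the set $\mathcal{P}(T)$ of periodic points of $T$ is dense in $X$, then $T$ is periodic, i.e. there is a positive integer $k$ such that $T^kx=x$ for all $x\in X$.
   Context: A solid order cone $K\subset\mathbb{R}^n$ is a closed convex cone that is solid (has nonempty interior $\operatorname{int}K$) and pointed (contains no affine line). A polyhedron is an intersection of finitely many closed affine halfspaces of $\mathbb{R}^n$. The $K$-order on $\mathbb{R}^n$ is the partial order given by $y\succeq x \iff y-x\in K$. A map $T$ is monotone for the $K$-order if $x\succeq y$ implies $Tx\succeq Ty$. For a positive integer $k$, a point $x$ has period $k$ if $T^kx=x$ (the period need not be minimal); $\mathcal{P}_k(T)$ is the set of such points, and $\mathcal{P}(T)=\bigcup_{k\ge1}\mathcal{P}_k(T)$ is the set of periodic points. *)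

(* Defs.v *)
From HB Require Import structures.
From mathcomp Require Import all_boot all_order all_algebra.
From mathcomp Require Import all_classical all_reals all_analysis.

Set Implicit Arguments.
Unset Strict Implicit.
Unset Printing Implicit Defensive.

Import Order.TTheory GRing.Theory Num.Theory.
Import numFieldNormedType.Exports.

Local Open Scope classical_set_scope.
Local Open Scope ring_scope.

(* R^n is 'rV[R]_n with its product topology; this makes sense for n = 0. *)

Definition convex_cone (R : realType) (n : nat) (K : set 'rV[R]_n) : Prop :=
  convex_set (K : set (convex_lmodType 'rV[R]_n)) /\
  (forall (t : R) (x : 'rV[R]_n), 0 <= t -> K x -> K (t *: x)).

Definition affine_line (R : realType) (n : nat) (p v : 'rV[R]_n) :
    set 'rV[R]_n :=
  range (fun t : R => p + t *: v).

Definition pointed_set (R : realType) (n : nat) (K : set 'rV[R]_n) : Prop :=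
  ~ exists p v : 'rV[R]_n, v != 0 /\ affine_line p v `<=` K.

Definition solid_order_cone (R : realType) (n : nat) (K : set 'rV[R]_n) :
    Prop :=
  [/\ closed K, convex_cone K, K° !=set0 & pointed_set K].

Definition closed_halfspace (R : realType) (n : nat) (H : set 'rV[R]_n) :
    Prop :=
  exists (a : 'rV[R]_n) (b : R), a != 0 /\
    H = [set x : 'rV[R]_n | \sum_(i < n) a 0 i * x 0 i <= b].

(* The empty family (m = 0) is allowed and gives the whole space; for n = 0
   it is the only possibility, as R^0 has no halfspaces. *)
Definition polyhedron (R : realType) (n : nat) (P : set 'rV[R]_n) : Prop :=
  exists (m : nat) (H : 'I_m -> set 'rV[R]_n),
    (forall i, closed_halfspace (H i)) /\ P = \bigcap_(i in setT) H i.

Definition cone_le (R : realType) (n : nat) (K : set 'rV[R]_n)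
    (x y : 'rV[R]_n) : Prop :=
  K (y - x).

(* Here and below a self-map of X is a total function whose values outside X
   are irrelevant, with the hypothesis set_fun X X T. *)
Definition cone_monotone (R : realType) (n : nat) (K X : set 'rV[R]_n)
    (T : 'rV[R]_n -> 'rV[R]_n) : Prop :=
  forall x y, X x -> X y -> cone_le K y x -> cone_le K (T y) (T x).

(* k need not be the minimal period. *)
Definition period_points (U : Type) (X : set U) (T : U -> U) (k : nat) :
    set U :=
  [set x | X x /\ iter k T x = x].

Definition periodic_points (U : Type) (X : set U) (T : U -> U) : set U :=
  \bigcup_(k in [set k : nat | (0 < k)%N]) period_points X T k.

(* The library predicate dense only concerns subsets dense in the whole space. *)
Definition dense_in (U : topologicalType) (A X : set U) : Prop :=
  A `<=` X /\ X `<=` closure A.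

(* Main.v *)
Require Import Defs.
From HB Require Import structures.
From mathcomp Require Import all_boot all_order all_algebra.
From mathcomp Require Import all_classical all_reals all_analysis.
From mathcomp Require Import ring lra zify.

Import Order.TTheory GRing.Theory Num.Theory.
Import numFieldNormedType.Exports.

Local Open Scope classical_set_scope.
Local Open Scope ring_scope.

(** Call [v >= 0] extremal when the order interval [[0, v]] is a chain; for a
    polyhedral cone there are finitely many extremal rays, and they generate it.
    If [T] fixes [p << q] and [[p, q]] lies in the interior of [X], density of
    the periodic points and compactness make [T] an order automorphism of
    [[p, q]], so at every fixed point it permutes the extremal segments. An
    interior point comparable with its image is fixed, again by density of
    periodic points, so a pigeonhole argument along sums of extremal vectors
    bounds the periods on [[p, q]]: [T] is locally of finite period on the
    interior of [X]. If moreover an iterate of [T] is the identity near one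
    point of such an interval, it fixes all extremal segments issued from nearby
    points, hence the whole interval; connectedness then gives a single period
    for the interior, and continuity extends it to [X]. *)

(** * The facet order, extremal vectors and generation of the cone *)

Section FacetOrder.
Context {R : realType} {n m : nat} (A : 'M[R]_(n, m)).
Implicit Types (x y z u v w d : 'rV[R]_n) (i : 'I_m).

(* The cone is [{x | x *m A >= 0}]: the columns of [A] are inward facet normals. *)
Definition facet i x : R := (x *m A) 0 i.

Lemma facetD i x y : facet i (x + y) = facet i x + facet i y.
Proof. by rewrite /facet mulmxDl mxE. Qed.

Lemma facetN i x : facet i (- x) = - facet i x.
Proof. by rewrite /facet mulNmx mxE. Qed.

Lemma facetZ i t x : facet i (t *: x) = t * facet i x.
Proof. by rewrite /facet -scalemxAl mxE. Qed.

Lemma facet0 i : facet i 0 = 0.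
Proof. by rewrite /facet mul0mx mxE. Qed.

Definition facetE := (facetD, facetN, facetZ, facet0).

Definition fle x y := forall i, facet i x <= facet i y.
(** As soon as some [e] satisfies [flt 0 e], this says that [y - x] is interior to the cone. *)
Definition flt x y := forall i, facet i x < facet i y.

Lemma fle_refl x : fle x x. Proof. by move=> i. Qed.

Lemma fle0P x : fle 0 x <-> forall i, 0 <= facet i x.
Proof. by split=> x0 i; have := x0 i; rewrite facet0. Qed.

Lemma fle_trans y x z : fle x y -> fle y z -> fle x z.
Proof. by move=> xy yz i; apply: le_trans (xy i) (yz i). Qed.

Lemma fltW x y : flt x y -> fle x y.
Proof. by move=> xy i; apply: ltW. Qed.

Lemma flt_le_trans y x z : flt x y -> fle y z -> flt x z.
Proof. by move=> xy yz i; apply: lt_le_trans (xy i) (yz i). Qed.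

Lemma fle_lt_trans y x z : fle x y -> flt y z -> flt x z.
Proof. by move=> xy yz i; apply: le_lt_trans (xy i) (yz i). Qed.

Lemma fle_sub0 x y : fle 0 (y - x) = fle x y.
Proof. by apply/propext; split=> xy i; have := xy i; rewrite !facetE subr_ge0. Qed.

Lemma fle_subr z x y : fle x (y - z) = fle (z + x) y.
Proof. by apply/propext; split=> xy i; have := xy i; rewrite !facetE lerBrDl. Qed.

Lemma fle_sub2r z x y : fle (x - z) (y - z) = fle x y.
Proof. by apply/propext; split=> xy i; have := xy i; rewrite !facetE lerD2r. Qed.

Lemma fle_sum s : (forall v, v \in s -> fle 0 v) -> fle 0 (\sum_(v <- s) v).
Proof.
move=> s0; rewrite big_seq; apply: (big_ind (fle 0)) => //.
by move=> x y /fle0P x0 /fle0P y0; apply/fle0P => i; rewrite facetD addr_ge0.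
Qed.

Lemma fle_addr x y : fle x (x + y) = fle 0 y.
Proof. by rewrite -(fle_sub0 x) addrC addKr. Qed.

(** For [x] in the cone this set encodes the smallest face containing [x]; that there are finitely
    many such sets drives the pigeonhole argument. *)
Definition zero_facets x := [set i | facet i x == 0]%SET.

(** Take [e] to be the inverse of a bound on all ratios [facet i w / facet i v]; where [facet i v]
    vanishes, so does [facet i w]. *)
Lemma scale_below v w : fle 0 v -> zero_facets v \subset zero_facets w ->
  exists2 e : R, 0 < e & fle (e *: w) v.
Proof.
move=> v0 /fintype.subsetP vw.
pose M := 1 + \sum_i `|facet i w / facet i v|.
have M0 : 0 < M by rewrite ltr_pwDl // sumr_ge0.
exists M^-1; rewrite ?invr_gt0 // => i; rewrite facetZ.
have := v0 i; rewrite facet0 le_eqVlt => /orP[vi|vi].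
  have : i \in zero_facets w by apply: vw; rewrite inE eq_sym.
  by rewrite inE => /eqP ->; rewrite mulr0; move: vi => /eqP <-.
rewrite ler_pdivrMl // -ler_pdivrMr //.
apply: le_trans (ler_norm _) _.
by rewrite /M (bigD1 i) //= addrCA lerDl addr_ge0 // sumr_ge0.
Qed.

Definition fcomparable x y := fle x y \/ fle y x.

(** Phrased through the order alone, so that order automorphisms preserve it; the zero vector counts
    as extremal. *)
Definition extremal v := fle 0 v /\
  forall u w, fle 0 u -> fle u v -> fle 0 w -> fle w v -> fcomparable u w.

Hypothesis A_free : row_free A.

Lemma facet_inj x y : (forall i, facet i x = facet i y) -> x = y.
Proof.
move=> xy; apply: (row_free_inj A_free); apply/rowP => i; exact: xy.
Qed.

Lemma fle_anti x y : fle x y -> fle y x -> x = y.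
Proof.
by move=> xy yx; apply: facet_inj => i; apply/eqP; rewrite eq_le xy yx.
Qed.

(** The ratios [facet i u / facet i v] agree wherever [facet i v] is positive, and their common
    value is [t]. *)
Lemma extremal_segment v u : extremal v -> fle 0 u -> fle u v ->
  exists2 t : R, 0 <= t & u = t *: v.
Proof.
move=> [v0 vch] u0 uv.
have {}u0 i : 0 <= facet i u by have := u0 i; rewrite facet0.
have {}v0 i : 0 <= facet i v by have := v0 i; rewrite facet0.
have [[i0 vi0]|v_eq0] := pselect (exists i, 0 < facet i v); last first.
  exists 0 => //; apply: facet_inj => i; rewrite scale0r facet0.
  apply/eqP; rewrite eq_le u0 andbT (le_trans (uv i)) // leNgt.
  by apply/negP => vi; apply: v_eq0; exists i.
(* A slope strictly between two ratios [facet i u / facet i v] would give a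
   multiple of [v] incomparable to [u]. *)
have ratio i k : 0 < facet i v -> 0 < facet k v ->
    facet i u / facet i v <= facet k u / facet k v.
  move=> vi vk; rewrite leNgt; apply/negP => lt_ratio.
  set t := (facet k u / facet k v + facet i u / facet i v) / 2.
  have ti : t < facet i u / facet i v by rewrite /t; lra.
  have tk : facet k u / facet k v < t by rewrite /t; lra.
  have t0 : 0 <= t.
    by apply: le_trans (ltW tk); rewrite divr_ge0 // ltW.
  have t1 : t <= 1.
    by apply: le_trans (ltW ti) _; rewrite ler_pdivrMr // mul1r uv.
  case: (vch u (t *: v)) => [j|//|j|j|/(_ i)|/(_ k)]; rewrite ?facetE //.
  - by rewrite mulr_ge0.
  - by have := v0 j; nra.
  - by rewrite leNgt -ltr_pdivlMr // ti.
  - by rewrite leNgt -ltr_pdivrMr // tk.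
exists (facet i0 u / facet i0 v); first by rewrite divr_ge0 // ltW.
apply: facet_inj => i; rewrite facetZ.
have := v0 i; rewrite le_eqVlt => /orP[/eqP vi|vi].
  rewrite -vi mulr0; apply/eqP; rewrite eq_le u0 andbT.
  by rewrite (le_trans (uv i)) // -vi.
have -> : facet i0 u / facet i0 v = facet i u / facet i v.
  by apply/eqP; rewrite eq_le !ratio.
by rewrite divfK // gt_eqF.
Qed.

Lemma fle_scale s t v : fle 0 v -> s <= t -> fle (s *: v) (t *: v).
Proof.
by move=> /fle0P v0 st i; rewrite !facetE ler_wpM2r.
Qed.

Lemma comparable_scale s t v : fle 0 v -> fcomparable (s *: v) (t *: v).
Proof.
by move=> v0; case: (leP s t) => [|/ltW] st; [left|right]; apply: fle_scale.
Qed.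

(** A small multiple of [w] lies below [v], hence on its ray. In particular the zero facets of a
    nonzero extremal vector determine its ray, so there are finitely many extremal rays. *)
Lemma extremal_comparable v w : extremal v -> fle 0 w ->
  zero_facets v \subset zero_facets w -> fcomparable v w.
Proof.
move=> ev w0 vw.
have [e e0 ewv] := scale_below v w ev.1 vw.
have [|t t0 ewt] := extremal_segment v (e *: w) ev _ ewv.
  by rewrite -(scaler0 _ e); move=> i; rewrite !facetZ ler_pM2l.
have -> : w = (t / e) *: v.
  by rewrite mulrC -scalerA -ewt scalerA mulVf ?scale1r ?gt_eqF.
by rewrite -{1}[v]scale1r; apply: comparable_scale ev.1.
Qed.

Lemma facet_exit x d i0 : fle 0 x -> zero_facets x \subset zero_facets d ->
  facet i0 d < 0 -> exists2 t : R, 0 < t &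
    fle 0 (x + t *: d) /\ zero_facets x \proper zero_facets (x + t *: d).
Proof.
move=> x0 xd di0.
have {}x0 i : 0 <= facet i x by have := x0 i; rewrite facet0.
have xpos i : facet i d < 0 -> 0 < facet i x.
  move=> di; rewrite lt_neqAle x0 andbT eq_sym; apply/eqP => xi.
  have /(fintype.subsetP xd) : i \in zero_facets x by rewrite inE xi.
  by rewrite inE => /eqP di1; rewrite di1 ltxx in di.
(* Ratio test: [i1] is the first facet reached when moving from [x] along [d]. *)
have [i1 di1 imin] := @Order.TotalTheory.arg_minP _ R _ i0
  (fun i => facet i d < 0) (fun i => facet i x / - facet i d) di0.
exists (facet i1 x / - facet i1 d); first by rewrite divr_gt0 ?oppr_gt0 ?xpos.
set t := _ / _ in imin *.
have t0 : 0 < t by rewrite divr_gt0 ?oppr_gt0 ?xpos.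
split.
  move=> i; rewrite !facetE; have [di|di] := ltP (facet i d) 0.
    by have := imin i di; rewrite ler_pdivlMr ?oppr_gt0 // mulrN -subr_ge0 opprK.
  exact: addr_ge0 (x0 i) (mulr_ge0 (ltW t0) di).
apply/fintype.properP; split.
  apply/fintype.subsetP => i xi; have := fintype.subsetP xd i xi.
  by move: xi; rewrite !inE !facetE => /eqP -> /eqP ->; rewrite mulr0 addr0.
exists i1; rewrite inE; last by rewrite gt_eqF ?xpos.
by rewrite !facetE /t invrN mulrN mulNr divfK ?subrr // lt_eqF.
Qed.

Lemma zero_facetsZ t x : t != 0 -> zero_facets (t *: x) = zero_facets x.
Proof.
by move=> t0; apply/setP => i; rewrite !inE facetZ mulf_eq0 (negPf t0).
Qed.

(** The difference [d] of two incomparable elements of [[0, x]] vanishes on the zero facets of [x]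
    and has facet values of both signs. Moving from [x] along [d] and [- d] therefore reaches new
    facets on both sides. *)
Lemma not_extremal_split x : fle 0 x -> ~ extremal x ->
  exists a b, [/\ x = a + b, fle 0 a, fle 0 b,
    zero_facets x \proper zero_facets a & zero_facets x \proper zero_facets b].
Proof.
move=> x0 nex.
have [d [xd [[i0 di0] [i1 di1]]]] : exists d, zero_facets x \subset zero_facets d
    /\ (exists i, facet i d < 0) /\ (exists i, facet i (- d) < 0).
  apply: contrapT => nd; apply: nex; split=> // u w u0 ux w0 wx.
  apply: contrapT => nuw; apply: nd; exists (u - w); split.
    apply/fintype.subsetP => i; rewrite !inE !facetE => /eqP xi.
    have := u0 i; have := w0 i; have := ux i; have := wx i.
    by rewrite xi facet0 => *; apply/eqP; lra.
  have lt_ex a b : ~ fle b a -> exists i, facet i a < facet i b.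
    move=> nba; apply: contrapT => nlt; apply: nba => i.
    by rewrite leNgt; apply/negP => lt_i; apply: nlt; exists i.
  split.
    have [i lti] : exists i, facet i u < facet i w.
      by apply: lt_ex => wu; apply: nuw; right.
    by exists i; rewrite !facetE subr_lt0.
  have [i lti] : exists i, facet i w < facet i u.
    by apply: lt_ex => uw; apply: nuw; left.
  by exists i; rewrite opprB !facetE subr_lt0.
have xd' : zero_facets x \subset zero_facets (- d).
  by rewrite -scaleN1r zero_facetsZ // oppr_eq0 oner_eq0.
have [s s0 [as0 xas]] := facet_exit x d i0 x0 xd di0.
have [t t0 [bt0 xbt]] := facet_exit x (- d) i1 x0 xd' di1.
have pos c y : 0 < c -> fle 0 y -> fle 0 (c *: y).
  by move=> c0 /fle0P y0; apply/fle0P => i; rewrite facetZ mulr_ge0 // ltW.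
(* These weights write [x] as a convex combination of the two exit points. *)
exists ((t / (s + t)) *: (x + s *: d)), ((s / (s + t)) *: (x + t *: - d)).
have st0 : 0 < s + t by apply: addr_gt0.
split; rewrite ?zero_facetsZ //; try (by apply: pos => //; apply: divr_gt0);
  try (by rewrite gt_eqF // divr_gt0).
apply: facet_inj => i; rewrite !facetE; field.
by rewrite gt_eqF.
Qed.

(** Each splitting strictly enlarges the set of zero facets, so the splitting tree has depth at most
    [m]. The bound on [size s] does not depend on [x], which later makes the period uniform on an
    interval. *)
Lemma extremal_sum x : fle 0 x -> exists s : seq 'rV[R]_n,
  [/\ (size s <= 2 ^ m)%N, forall v, v \in s -> extremal v
    & x = \sum_(v <- s) v].
Proof.
suff main r : forall y, (m - #|zero_facets y| <= r)%N -> fle 0 y ->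
    exists s : seq 'rV[R]_n, [/\ (size s <= 2 ^ r)%N,
      forall v, v \in s -> extremal v & y = \sum_(v <- s) v].
  by apply: main; rewrite leq_subr.
have one y r' : extremal y -> exists s : seq 'rV[R]_n, [/\ (size s <= 2 ^ r')%N,
      forall v, v \in s -> extremal v & y = \sum_(v <- s) v].
  move=> ey; exists [:: y]; split; rewrite ?big_seq1 ?expn_gt0 //.
  by move=> v; rewrite inE => /eqP ->.
(* For [r = 0] a splitting would give [a] more than [m] zero facets. *)
elim: r => [|r IHr] y yr y0; (have [ey|ney] := pselect (extremal y);
    first exact: one); have [a [b [yab a0 b0 ya yb]]] := not_extremal_split y y0 ney;
  have := proper_card ya; have := proper_card yb;
  have : (#|zero_facets a| <= m)%N by rewrite (leq_trans (max_card _)) ?card_ord.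
  by lia.
move=> _ cb ca.
have [|sa [sza esa ya']] := IHr a _ a0; first by lia.
have [|sb [szb esb yb']] := IHr b _ b0; first by lia.
exists (sa ++ sb); split.
- by rewrite size_cat expnS mul2n -addnn leq_add.
- by move=> v; rewrite mem_cat => /orP[]; [apply: esa|apply: esb].
- by rewrite big_cat /= -ya' -yb'.
Qed.

End FacetOrder.

(** * Topology of the facet order *)

Lemma nbhs_segment (R : realType) (n : nat) (z w : 'rV[R]_n) V : nbhs z V ->
  exists2 e : R, 0 < e & forall t, 0 <= t <= e -> V (z + t *: w).
Proof.
move=> zV; have cw : (fun t : R => z + t *: w) @ 0 --> z.
  rewrite -[X in _ --> X]addr0 -(scale0r w).
  apply: cvgD; first exact: cvg_cst.
  exact: cvgZr_tmp.
have /nbhs_ballP[e /= e0 eV] := cw _ zV.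
exists (e / 2); first by rewrite divr_gt0.
move=> t /andP[t0 te]; apply: eV => /=.
rewrite /ball /= sub0r normrN ger0_norm // (le_lt_trans te) //.
by rewrite ltr_pdivrMr // ltr_pMr // ltr1n.
Qed.

Section FacetTopology.
Context {R : realType} {n m : nat} (A : 'M[R]_(n, m)).
Implicit Types (x y z p q : 'rV[R]_n).

Lemma facet_continuous i : continuous (facet A i).
Proof.
have -> : facet A i = fun x : 'rV[R]_n => \sum_j x 0 j * A j i.
  by apply: funext => x; rewrite /facet mxE.
apply: continuous_big => [|j _ x]; first exact: add_continuous.
rewrite /continuous_at; have cj := @coord_continuous R 1 n 0 j x.
exact: (cvgM cj (cvg_cst _)).
Qed.

Lemma near_flt_l x y : flt A x y -> \forall z \near x, flt A z y.
Proof.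
move=> xy.
apply: (@filter_forall _ _ (fun i z => facet A i z < facet A i y) (nbhs x)) => i.
exact: (facet_continuous i x _ (open_nbhs_nbhs (conj (@open_lt _ _) (xy i)))).
Qed.

Lemma near_flt_r x y : flt A x y -> \forall z \near y, flt A x z.
Proof.
move=> xy.
apply: (@filter_forall _ _ (fun i z => facet A i x < facet A i z) (nbhs y)) => i.
exact: (facet_continuous i y _ (open_nbhs_nbhs (conj (@open_gt _ _) (xy i)))).
Qed.

Lemma near_not_fle x y : ~ fle A x y -> \forall z \near y, ~ fle A x z.
Proof.
move=> nxy; have [i lti] : exists i, facet A i y < facet A i x.
  apply: contrapT => nlt; apply: nxy => i; rewrite leNgt; apply/negP => lti.
  by apply: nlt; exists i.
have near_lt := facet_continuous i y _ (open_nbhs_nbhs (conj (@open_lt _ _) lti)).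
apply: (@filterS _ (nbhs y) _ _ _ _ near_lt) => z /= ltz /(_ i).
by rewrite leNgt ltz.
Qed.

Definition order_interval p q := [set y | fle A p y /\ fle A y q].

Hypothesis A_free : row_free A.

(** A right inverse of [A] expresses the coordinates linearly through the facet values. *)
Lemma facet_bound : exists2 C : R, 0 < C & forall c x j, 0 <= c ->
  (forall i, `|facet A i x| <= c) -> `|x 0 j| <= C * c.
Proof.
have /row_freeP[B AB] := A_free.
have S0 j : 0 <= \sum_i `|B i j| by rewrite sumr_ge0.
exists (1 + \sum_j \sum_i `|B i j|).
  by rewrite ltr_pwDl // sumr_ge0 // => j _.
move=> c x j c0 xc.
have -> : x 0 j = \sum_i facet A i x * B i j.
  by rewrite -[x in LHS]mulmx1 -AB mulmxA mxE.
apply: le_trans (ler_norm_sum _ _ _) _.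
apply: (@le_trans _ _ (\sum_i `|B i j| * c)).
  by apply: ler_sum => i _; rewrite normrM mulrC ler_wpM2l.
rewrite -mulr_suml ler_wpM2r // (bigD1 j) //= addrCA lerDl.
by rewrite addr_ge0 // sumr_ge0.
Qed.

Lemma order_interval_compact p q : compact (order_interval p q).
Proof.
have [C C0 boundC] := facet_bound.
apply: bounded_closed_compact; last first.
  move=> y ypq; split=> i; rewrite leNgt; apply/negP => lti.
    have [z [[pz _] ltz]] := ypq _ (facet_continuous i y _
      (open_nbhs_nbhs (conj (@open_lt _ _) lti))).
    by have := pz i; rewrite leNgt ltz.
  have [z [[_ zq] ltz]] := ypq _ (facet_continuous i y _
    (open_nbhs_nbhs (conj (@open_gt _ _) lti))).
  by have := zq i; rewrite leNgt ltz.
pose c := \sum_i (`|facet A i p| + `|facet A i q|).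
have c0 : 0 <= c by apply: sumr_ge0 => i _; apply: addr_ge0.
exists (C * c); split; first exact: num_real.
move=> M cM x [px xq]; rewrite /Num.Def.normr /= mx_normrE.
have M0 : 0 <= M by rewrite ltW // (le_lt_trans _ cM) // mulr_ge0 // ltW.
apply/bigmax_leP; split=> // -[i j] _ /=; rewrite ord1.
apply: le_trans (ltW cM); apply: boundC => // k.
have ck : `|facet A k p| + `|facet A k q| <= c.
  by rewrite /c (bigD1 k) //= lerDl sumr_ge0 // => l _; apply: addr_ge0.
have := px k; have := xq k; have := ler_norm (facet A k q).
have := ler_norm (- facet A k p); rewrite normrN.
have := normr_ge0 (facet A k p); have := normr_ge0 (facet A k q).
by move=> *; rewrite ler_norml; apply/andP; split; lra.
Qed.

Lemma order_interval_small e x V : flt A 0 e -> nbhs x V ->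
  exists2 t : R, 0 < t & order_interval (x - t *: e) (x + t *: e) `<=` V.
Proof.
move=> e0 /nbhs_ballP[r /= r0 rV]; have [C C0 boundC] := facet_bound.
have {}e0 i : 0 < facet A i e by have := e0 i; rewrite facet0.
pose E := 1 + \sum_i facet A i e.
have E0 : 0 < E by rewrite ltr_pwDl // sumr_ge0 // => i _; apply: ltW.
have eE i : facet A i e <= E.
  rewrite /E (bigD1 i) //= addrCA lerDl addr_ge0 // sumr_ge0 // => k _.
  exact: ltW.
(* Facet values of [y - x] are then at most [t * E], so its coordinates are at most
   [C * (t * E) = r / 2]. *)
pose t := r / (2 * C * E).
have t0 : 0 < t by rewrite divr_gt0 // !mulr_gt0.
exists t => // y [ly uy]; apply: rV; split=> // i j; rewrite ord1.
rewrite /ball /= distrC.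
have -> : y 0 j - x 0 j = (y - x) 0 j by rewrite !mxE.
apply: (@le_lt_trans _ _ (C * (t * E))).
  apply: boundC => [|k]; first by rewrite mulr_ge0 // ltW.
  have := ly k; have := uy k; rewrite !facetE => uk lk.
  have : t * facet A k e <= t * E by rewrite ler_wpM2l // ltW.
  by move=> te; rewrite ler_norml; apply/andP; split; lra.
have -> : C * (t * E) = r / 2 by rewrite /t; field; rewrite !gt_eqF.
by lra.
Qed.

End FacetTopology.

(** * The reversed order, presented by [- A] *)

Section Reversal.
Context {R : realType} {n m : nat} (A : 'M[R]_(n, m)).
Implicit Types x y : 'rV[R]_n.

Lemma facet_opp i x : facet (- A) i x = - facet A i x.
Proof. by rewrite /facet mulmxN mxE. Qed.

Lemma fle_opp x y : fle (- A) x y = fle A y x.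
Proof.
by apply/propext; split=> xy i; have := xy i; rewrite !facet_opp lerN2.
Qed.

Lemma flt_opp x y : flt (- A) x y = flt A y x.
Proof.
by apply/propext; split=> xy i; have := xy i; rewrite !facet_opp ltrN2.
Qed.

Lemma row_free_opp : row_free A -> row_free (- A).
Proof. by rewrite /row_free mxrank_opp. Qed.

End Reversal.

(** * Monotone systems with dense periodic points *)

(** The hypotheses on [T] in pointwise form, a package stable under order reversal ([sys_opp]) and
    under positive iterates ([sys_iter]). *)
Record monotone_system {R : realType} {n m : nat} (A : 'M[R]_(n, m))
    (X : set 'rV[R]_n) (T : 'rV[R]_n -> 'rV[R]_n) : Prop := MonotoneSystem {
  sys_self : forall x, X x -> X (T x);
  sys_inj : forall x y, X x -> X y -> T x = T y -> x = y;
  sys_cont : forall x V, X x -> nbhs (T x) V ->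
    nbhs x [set y | X y -> V (T y)];
  sys_mono : forall x y, X x -> X y -> fle A x y -> fle A (T x) (T y);
  sys_dense : forall x V, X x -> nbhs x V ->
    exists y j, [/\ X y, V y, (0 < j)%N & iter j T y = y] }.

Lemma iterM_fix (U : Type) (f : U -> U) k j x :
  iter k f x = x -> iter (j * k) f x = x.
Proof. by move=> fx; rewrite iterM; apply: iter_fix. Qed.

Lemma iter_comm (U : Type) (f : U -> U) k j x :
  iter k (iter j f) x = iter j (iter k f) x.
Proof. by rewrite -!iterM mulnC. Qed.

Section System.
Context {R : realType} {n m : nat}.
Implicit Types (A : 'M[R]_(n, m)) (X : set 'rV[R]_n) (T : 'rV[R]_n -> 'rV[R]_n).
Implicit Types (x y z u v w p q : 'rV[R]_n).

Lemma sys_opp A X T : monotone_system A X T -> monotone_system (- A) X T.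
Proof.
case=> self inj cont mono dense; split=> // x y Xx Xy.
by rewrite !fle_opp; apply: mono.
Qed.

Lemma sys_iter_self A X T k x : monotone_system A X T -> X x -> X (iter k T x).
Proof. by move=> sysT Xx; elim: k => //= k; apply: sys_self sysT _. Qed.

Lemma sys_iter_mono A X T k x y : monotone_system A X T -> X x -> X y ->
  fle A x y -> fle A (iter k T x) (iter k T y).
Proof.
move=> sysT Xx Xy xy; elim: k => //= k IHk.
by apply: (sys_mono _ _ _ sysT) IHk; apply: sys_iter_self sysT _.
Qed.

Lemma sys_iter A X T k : (0 < k)%N -> monotone_system A X T ->
  monotone_system A X (iter k T).
Proof.
move=> k0 sysT; split.
- by move=> x; apply: sys_iter_self sysT.
- move=> x y Xx Xy; elim: k {k0} => //= k IHk.
  move/(sys_inj _ _ _ sysT) => eq_k; apply: IHk; apply: eq_k;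
    exact: sys_iter_self sysT _.
- move=> x V Xx; elim: k {k0} V => [V xV|k IHk V /= xV].
    by apply: (@filterS _ (nbhs x) _ _ _ _ xV) => y Vy.
  have := IHk _ (sys_cont _ _ _ sysT _ _ (sys_iter_self _ _ _ k _ sysT Xx) xV).
  apply: (@filterS _ (nbhs x)) => y /= Vy Xy.
  exact: Vy Xy (sys_iter_self _ _ _ k _ sysT Xy).
- by move=> x y; apply: sys_iter_mono sysT.
move=> x V Xx xV; have [y [j [Xy Vy j0 yj]]] := sys_dense _ _ _ sysT x V Xx xV.
by exists y, j; split=> //; rewrite iter_comm; apply: iter_fix.
Qed.

(* Periodic points just above [x] lie above all forward images of [x], hence
   above [T x]; so [x < T x] is impossible, as [x] is a limit of such points. *)
Lemma fixed_of_le_image A e X T x : row_free A -> flt A 0 e ->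
  monotone_system A X T -> X° x -> fle A x (T x) -> T x = x.
Proof.
move=> A_free e0 sysT Xx xTx; have X_x := nbhs_singleton Xx.
apply: (fle_anti A A_free) => //; apply: contrapT => nTxx.
pose V := [set y | ~ fle A (T x) y] `&` X.
have xV : nbhs x V by apply: filterI Xx; apply: near_not_fle.
have [t t0 tV] := nbhs_segment _ _ x e _ (nbhs_interior xV).
set y0 := x + t *: e.
have y0V : nbhs y0 V by apply: tV; rewrite lexx ltW.
have xy0 : flt A x y0.
  by move=> i; have := e0 i; rewrite !facetE => ei; rewrite ltrDl mulr_gt0.
have [] := sys_dense _ _ _ sysT y0 _ (nbhs_singleton y0V).2
  (filterI y0V (near_flt_r A _ _ xy0)).
move=> y [j [Xy [[nTxy _] xy] j0 yj]]; apply: nTxy; rewrite -yj.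
case: j j0 {yj} => // j _; elim: j => [|j IHj].
  by apply: (sys_mono _ _ _ sysT) => //; apply: fltW.
apply: (fle_trans A (T (T x))).
  by apply: (sys_mono _ _ _ sysT) => //; apply: sys_self sysT _ _.
rewrite iterS; apply: (sys_mono _ _ _ sysT) IHj.
  exact: sys_self sysT _ _.
exact: sys_iter_self sysT _.
Qed.

Lemma fixed_of_comparable A e X T x : row_free A -> flt A 0 e ->
  monotone_system A X T -> X° x -> fcomparable A x (T x) -> T x = x.
Proof.
move=> A_free e0 sysT Xx [xTx|Txx].
  exact: fixed_of_le_image A_free e0 sysT Xx xTx.
apply: (fixed_of_le_image (- A) (- e)) (row_free_opp _ A_free) _ _ Xx _.
- by rewrite flt_opp; move=> i; have := e0 i; rewrite !facetE oppr_lt0.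
- exact: sys_opp.
- by rewrite fle_opp.
Qed.

End System.

(** * Order automorphisms of intervals with fixed endpoints *)

Section InvariantInterval.
Context {R : realType} {n m : nat} (A : 'M[R]_(n, m)) (A_free : row_free A).
Context (X : set 'rV[R]_n) (p q : 'rV[R]_n).
Hypothesis pq : flt A p q.
Hypothesis pqX : order_interval A p q `<=` X°.
Implicit Types (T : 'rV[R]_n -> 'rV[R]_n) (x y z u v w a b : 'rV[R]_n).
Implicit Type s : seq 'rV[R]_n.

Let X_of_interval x : order_interval A p q x -> X x.
Proof. by move=> /pqX/nbhs_singleton. Qed.

Lemma order_interval_image T x : monotone_system A X T -> T p = p -> T q = q ->
  order_interval A p q x -> order_interval A p q (T x).
Proof.
move=> sysT Tp Tq xpq; have [px xq] := xpq.
have ppq : order_interval A p q p by split; [apply: fle_refl|apply: fltW].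
have qpq : order_interval A p q q by split; [apply: fltW|apply: fle_refl].
split; [rewrite -Tp|rewrite -Tq]; apply: (sys_mono _ _ _ sysT) => //;
  exact: X_of_interval.
Qed.

(** Surjectivity of [T] on ordered pairs, rather than on points, yields both surjectivity on the
    interval and reflection of the order. *)
Definition ordered_pairs := [set uv : 'rV[R]_n * 'rV[R]_n |
  [/\ order_interval A p q uv.1, order_interval A p q uv.2 & fle A uv.1 uv.2]].

Lemma ordered_pairs_compact : compact ordered_pairs.
Proof.
have -> : ordered_pairs = (order_interval A p q `*` order_interval A p q) `&`
    [set uv | fle A uv.1 uv.2].
  by apply/seteqP; split=> [uv [? ? ?]|uv [[? ?] ?]].
apply: compact_closedI; first by apply: compact_setX; apply: order_interval_compact.
move=> [u v] uvcl i /=; rewrite leNgt; apply/negP => lti.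
pose c := (facet A i u + facet A i v) / 2.
have cu : c < facet A i u by rewrite /c; lra.
have vc : facet A i v < c by rewrite /c; lra.
have [|[u' v'] /= [/(_ i) le_uv [cu' vc']]] := uvcl
    ([set y | c < facet A i y] `*` [set y | facet A i y < c]).
  exists ([set y | c < facet A i y], [set y | facet A i y < c]) => //; split=> /=.
    exact: (facet_continuous A i u _ (open_nbhs_nbhs (conj (@open_gt _ _) cu))).
  exact: (facet_continuous A i v _ (open_nbhs_nbhs (conj (@open_lt _ _) vc))).
by move: le_uv => /=; rewrite leNgt (lt_trans vc' cu').
Qed.

(** The pair is first pushed to a strictly ordered one, whose order survives small perturbations;
    density then supplies a periodic point near each entry, and the product of the two periods
    serves both. *)
Lemma near_ordered_periodic T a b Wa Wb : monotone_system A X T ->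
  ordered_pairs (a, b) -> nbhs a Wa -> nbhs b Wb ->
  exists a' b' j, [/\ Wa a', Wb b', ordered_pairs (a', b'), (0 < j)%N
    & iter j T a' = a' /\ iter j T b' = b'].
Proof.
move=> sysT [/= [pa aq] [pb bq] ab] aWa bWb.
(* As [c1] is strictly below [c2], moving [a] towards [c1] and [b] towards [c2] by the same fraction
   separates them strictly, even if [a = b]. *)
pose c1 := (2 / 3) *: p + (1 / 3) *: q; pose c2 := (1 / 3) *: p + (2 / 3) *: q.
have [ta ta0 taW] := nbhs_segment _ _ a (c1 - a) _ (nbhs_interior aWa).
have [tb tb0 tbW] := nbhs_segment _ _ b (c2 - b) _ (nbhs_interior bWb).
pose t := Num.min (Num.min ta tb) 1.
have t0 : 0 < t by rewrite !lt_min ta0 tb0 ltr01.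
have t1 : t <= 1 by rewrite ge_min lexx orbT.
have tta : t <= ta by rewrite !ge_min lexx.
have ttb : t <= tb by rewrite !ge_min lexx orbT.
pose at' := a + t *: (c1 - a); pose bt := b + t *: (c2 - b).
have atW : nbhs at' Wa by apply: taW; rewrite ltW.
have btW : nbhs bt Wb by apply: tbW; rewrite ltW.
pose mid := (1 / 2) *: (at' + bt).
have gap i : 0 < t * (facet A i q - facet A i p).
  by rewrite mulr_gt0 // subr_gt0.
have shrink x y i : fle A x y -> 0 <= (1 - t) * (facet A i y - facet A i x).
  by move=> xy; rewrite mulr_ge0 ?subr_ge0.
have p_at : flt A p at'.
  move=> i; rewrite /at' /c1 !facetE; have := gap i; have := shrink _ _ i pa.
  by lra.
have at_mid : flt A at' mid.
  move=> i; rewrite /mid /at' /bt /c1 /c2 !facetE.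
  by have := gap i; have := shrink _ _ i ab; lra.
have mid_bt : flt A mid bt.
  move=> i; rewrite /mid /at' /bt /c1 /c2 !facetE.
  by have := gap i; have := shrink _ _ i ab; lra.
have bt_q : flt A bt q.
  move=> i; rewrite /bt /c2 !facetE; have := gap i; have := shrink _ _ i bq.
  by lra.
have p_mid : flt A p mid by move=> i; apply: lt_trans (p_at i) (at_mid i).
have mid_q : flt A mid q by move=> i; apply: lt_trans (mid_bt i) (bt_q i).
have Xat : X at'.
  apply: X_of_interval; split; first exact: fltW.
  by move=> i; apply: ltW; apply: lt_trans (at_mid i) (mid_q i).
have Xbt : X bt.
  apply: X_of_interval; split; last exact: fltW.
  by move=> i; apply: ltW; apply: lt_trans (p_mid i) (mid_bt i).
have [a' [ja [_ [[Wa' pa'] a'mid] ja0 a'j]]] := sys_dense _ _ _ sysT at' _ Xat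
  (filterI (filterI atW (near_flt_r A _ _ p_at)) (near_flt_l A _ _ at_mid)).
have [b' [jb [_ [[Wb' midb'] b'q] jb0 b'j]]] := sys_dense _ _ _ sysT bt _ Xbt
  (filterI (filterI btW (near_flt_r A _ _ mid_bt)) (near_flt_l A _ _ bt_q)).
have a'b' : flt A a' b' by move=> i; apply: lt_trans (a'mid i) (midb' i).
exists a', b', (ja * jb)%N; split=> //; last 2 first.
- by rewrite muln_gt0 ja0.
- by split; [rewrite mulnC|]; apply: iterM_fix.
split=> /=; [split|split|]; try exact: fltW.
- by move=> i; apply: ltW; apply: lt_trans (a'mid i) (mid_q i).
- by move=> i; apply: ltW; apply: lt_trans (p_mid i) (midb' i).
Qed.

(* [T] maps the compact set of ordered pairs onto a closed set, which contains
   the dense set of pairs of periodic points. *)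
Lemma ordered_pairs_surj T a b : monotone_system A X T -> T p = p -> T q = q ->
  ordered_pairs (a, b) ->
  exists u v, [/\ ordered_pairs (u, v), T u = a & T v = b].
Proof.
move=> sysT Tp Tq ab.
pose F (uv : 'rV[R]_n * 'rV[R]_n) := (T uv.1, T uv.2).
suff [[u v] /= uv [<- <-]] : (F @` ordered_pairs) (a, b) by exists u, v.
have /compact_closed : compact (F @` ordered_pairs).
  apply: continuous_compact ordered_pairs_compact.
  apply/subspace_continuousP => -[u v] [/= upq vpq _] W [[W1 W2] [/= uW1 vW2] sW].
  exists ([set y | X y -> W1 (T y)], [set y | X y -> W2 (T y)]) => /=.
    by split; apply: (sys_cont _ _ _ sysT) => //; apply: X_of_interval.
  move=> [y1 y2] /= [Wy1 Wy2] [/= y1pq y2pq _]; apply: sW; split=> /=.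
    exact: Wy1 (X_of_interval _ y1pq).
  exact: Wy2 (X_of_interval _ y2pq).
apply; first exact: norm_hausdorff.
move=> W [[W1 W2] [/= aW1 bW2] sW].
have [a' [b' [j [Wa' Wb' ab' j0 [a'j b'j]]]]] :=
  near_ordered_periodic T a b W1 W2 sysT ab aW1 bW2.
exists (a', b'); split; last exact: sW.
case: j j0 a'j b'j => // j _ /= a'j b'j.
exists (iter j T a', iter j T b'); last by rewrite /F /= a'j b'j.
have [/= a'pq b'pq le_ab'] := ab'.
have stable k x : order_interval A p q x -> order_interval A p q (iter k T x).
  by move=> xpq; elim: k => //= k; apply: order_interval_image.
split=> /=; [exact: stable|exact: stable|].
by apply: sys_iter_mono sysT _ _ le_ab'; apply: X_of_interval.
Qed.

Lemma order_interval_surj T a : monotone_system A X T -> T p = p -> T q = q ->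
  order_interval A p q a -> exists2 u, order_interval A p q u & T u = a.
Proof.
move=> sysT Tp Tq apq.
have [|u [_ [[/= upq _ _] Tu _]]] := ordered_pairs_surj T a a sysT Tp Tq.
  by split=> //; apply: fle_refl.
by exists u.
Qed.

(** The ordered pair [(T u, T v)] is the image of an ordered pair, which by injectivity is
    [(u, v)]. *)
Lemma order_interval_reflect T u v : monotone_system A X T -> T p = p -> T q = q ->
  order_interval A p q u -> order_interval A p q v -> fle A (T u) (T v) -> fle A u v.
Proof.
move=> sysT Tp Tq upq vpq Tuv.
have [|u' [v' [[/= u'pq v'pq u'v'] Tu Tv]]] :=
    ordered_pairs_surj T (T u) (T v) sysT Tp Tq.
  by split=> //=; apply: order_interval_image.
have inj := sys_inj _ _ _ sysT.
by rewrite -(inj _ _ _ _ Tu) -1?(inj _ _ _ _ Tv) //; apply: X_of_interval.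
Qed.

Lemma iter_interval_reflect T k u v : monotone_system A X T ->
  T p = p -> T q = q -> order_interval A p q u -> order_interval A p q v ->
  fle A (iter k T u) (iter k T v) -> fle A u v.
Proof.
move=> sysT Tp Tq upq vpq; case: k => // k.
by apply: order_interval_reflect; rewrite ?iter_fix //; apply: sys_iter sysT.
Qed.

(** As an order automorphism of [[p, q]] fixing [z], the map [T] carries [[z, x]] onto [[z, T x]],
    and chains to chains. *)
Lemma extremal_image T z x : monotone_system A X T -> T p = p -> T q = q ->
  T z = z -> order_interval A p q z -> order_interval A p q x ->
  extremal A (x - z) -> extremal A (T x - z).
Proof.
move=> sysT Tp Tq Tz zpq xpq [zx ch].
rewrite fle_sub0 in zx.
have Tzx : fle A z (T x).
  by rewrite -Tz; apply: (sys_mono _ _ _ sysT) => //; apply: X_of_interval.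
split=> [|u w]; first by rewrite fle_sub0.
rewrite -[u](addrK z) -[w](addrK z) -/(_ - z) !(addrC _ z).
set y1 := z + u; set y2 := z + w; rewrite !fle_sub0 !fle_sub2r => zy1 y1x zy2 y2x.
have [y1' [y1'pq Ty1 zy1' y1'x]] : exists y,
    [/\ order_interval A p q y, T y = y1, fle A z y & fle A y x].
  have y1pq : order_interval A p q y1.
    split; first exact: fle_trans zpq.1 zy1.
    by apply: fle_trans y1x _; have [] := order_interval_image T x sysT Tp Tq xpq.
  have [y ypq Ty] := order_interval_surj T y1 sysT Tp Tq y1pq.
  by exists y; split=> //; apply: (order_interval_reflect T) => //; rewrite Ty ?Tz.
have [y2' [y2'pq Ty2 zy2' y2'x]] : exists y,
    [/\ order_interval A p q y, T y = y2, fle A z y & fle A y x].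
  have y2pq : order_interval A p q y2.
    split; first exact: fle_trans zpq.1 zy2.
    by apply: fle_trans y2x _; have [] := order_interval_image T x sysT Tp Tq xpq.
  have [y ypq Ty] := order_interval_surj T y2 sysT Tp Tq y2pq.
  by exists y; split=> //; apply: (order_interval_reflect T) => //; rewrite Ty ?Tz.
have := ch (y1' - z) (y2' - z).
rewrite !fle_sub0 !fle_sub2r => /(_ zy1' y1'x zy2' y2'x).
rewrite /fcomparable !fle_sub2r -Ty1 -Ty2.
by case=> le_y; [left|right]; apply: (sys_mono _ _ _ sysT) => //;
  apply: X_of_interval.
Qed.

End InvariantInterval.

(** * Finite period near interior points *)

Section LocalPeriod.
Context {R : realType} {n m : nat} (A : 'M[R]_(n, m)) (A_free : row_free A).
Context (e : 'rV[R]_n) (e0 : flt A 0 e) (X : set 'rV[R]_n).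
Implicit Types (T : 'rV[R]_n -> 'rV[R]_n) (p q x y z u v w : 'rV[R]_n).
Implicit Type s : seq 'rV[R]_n.

(** The number of sets of facets bounds the return time of an extremal ray; its factorial is a
    multiple of every possible return time. *)
Definition ray_period : nat := (#|{: {set 'I_m}}| `!)%N.

(* The directions [iter j T x - z] are extremal, and there are finitely many
   extremal rays, so two of the iterates of [x] are comparable. *)
Lemma ray_fixed p q T z x : flt A p q -> order_interval A p q `<=` X° ->
  monotone_system A X T -> T p = p -> T q = q -> T z = z ->
  order_interval A p q z -> order_interval A p q x -> extremal A (x - z) ->
  iter ray_period T x = x.
Proof.
move=> pq pqX sysT Tp Tq Tz zpq xpq ext.
have [stable ext_iter] : (forall j, order_interval A p q (iter j T x)) /\
    forall j, extremal A (iter j T x - z).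
  suff both j : order_interval A p q (iter j T x) /\ extremal A (iter j T x - z).
    by split=> j; have [] := both j.
  elim: j => //= j [jpq jext]; split.
    exact: (order_interval_image A X p q pq pqX T _ sysT).
  exact: (extremal_image A A_free X p q pq pqX T).
pose N := #|{: {set 'I_m}}|.
pose f (j : 'I_N.+1) := zero_facets A (iter j T x - z).
have [a [b [ab fab]]] : exists a b : 'I_N.+1, (a < b)%N /\ f a = f b.
  have /injectivePn[a [b ab fab]] : ~~ injectiveb f.
    apply/negP => /injectiveP /leq_card; rewrite card_ord.
    by rewrite ltnn.
  by have [lt_ab|lt_ba|/val_inj eq_ab] := ltngtP a b;
    [exists a, b|exists b, a|rewrite eq_ab eqxx in ab].
have cmp_ab : fcomparable A (iter a T x) (iter b T x).
  have := extremal_comparable A A_free (iter a T x - z) (iter b T x - z)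
    (ext_iter a) (ext_iter b).1.
  by rewrite /fcomparable !fle_sub2r; apply; rewrite -/(f a) -/(f b) fab.
pose d := (b - a)%N.
have d0 : (0 < d)%N by rewrite subn_gt0.
have dN : (d <= N)%N by rewrite (leq_trans (leq_subr _ _)) // -ltnS.
(* [iter a T] reflects the order on [[p, q]], so the comparison pulls back to one between [x] and
   its image under [iter d T]. *)
have cmp_d : fcomparable A x (iter d T x).
  have iter_b : iter b T x = iter a T (iter d T x).
    by rewrite -iterD subnKC // ltnW.
  by case: cmp_ab; rewrite iter_b => le_ab; [left|right];
    apply: (iter_interval_reflect A A_free X p q pq pqX T a) le_ab.
have /dvdnP[c Nc] : (d %| ray_period)%N by rewrite dvdn_fact // d0.
rewrite Nc; apply: iterM_fix.
apply: (fixed_of_comparable A e X) cmp_d => //; last exact: pqX.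
exact: sys_iter.
Qed.

(** Induction on [s]: the partial sum [z] is fixed by an iterate of [T], and the next point differs
    from [z] by an extremal vector, so [ray_fixed] for that iterate costs one more factor
    [ray_period]. *)
Lemma ray_sum_fixed p q T s : flt A p q -> order_interval A p q `<=` X° ->
  monotone_system A X T -> T p = p -> T q = q ->
  (forall v, v \in s -> extremal A v) -> fle A (p + \sum_(v <- s) v) q ->
  iter (ray_period ^ size s) T (p + \sum_(v <- s) v) = p + \sum_(v <- s) v.
Proof.
move=> pq pqX sysT Tp Tq.
have N0 : (0 < ray_period)%N by rewrite fact_gt0.
elim: s => [_ _|v s IHs ext]; first by rewrite big_nil addr0.
rewrite big_cons => le_q; set z := p + \sum_(w <- s) w.
have ext_v : extremal A v by apply: ext; rewrite mem_head.
have ext_s w : w \in s -> extremal A w by move=> ws; apply: ext; rewrite inE ws orbT.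
have z_x : fle A z (p + (v + \sum_(w <- s) w)).
  by rewrite addrCA [v + _]addrC fle_addr; case: ext_v.
have Tz : iter (ray_period ^ size s) T z = z.
  by apply: IHs => //; apply: fle_trans z_x le_q.
have s0 : fle A 0 (\sum_(w <- s) w).
  by apply: fle_sum => w ws; have [] := ext_s w ws.
have pz : fle A p z by rewrite fle_addr.
have zpq : order_interval A p q z by split=> //; apply: fle_trans z_x le_q.
have xpq : order_interval A p q (p + (v + \sum_(w <- s) w)).
  by split=> //; apply: fle_trans pz z_x.
have fixk y : T y = y -> iter (ray_period ^ size s) T y = y.
  by move=> Ty; apply: iter_fix.
rewrite /= expnS iterM.
apply: (ray_fixed p q _ z) => //; [|exact: fixk|exact: fixk|].
  by apply: sys_iter; rewrite // expn_gt0 N0.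
by rewrite /z addrCA addrK.
Qed.

Lemma interval_period p q T : flt A p q -> order_interval A p q `<=` X° ->
  monotone_system A X T -> T p = p -> T q = q ->
  exists2 k, (0 < k)%N & forall x, order_interval A p q x -> iter k T x = x.
Proof.
move=> pq pqX sysT Tp Tq.
have N0 : (0 < ray_period)%N by rewrite fact_gt0.
exists (ray_period ^ (2 ^ m))%N; first by rewrite expn_gt0 N0.
move=> x [px xq].
have [s [sm ext xs]] : exists s : seq 'rV[R]_n,
    [/\ (size s <= 2 ^ m)%N, forall v, v \in s -> extremal A v
      & x - p = \sum_(v <- s) v].
  by apply: extremal_sum; rewrite ?fle_sub0.
have -> : x = p + \sum_(v <- s) v by rewrite -xs addrC subrK.
(* The exponent [size s] is padded to [2 ^ m], so that one period serves all [x]. *)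
rewrite -(subnK sm) expnD; apply: iterM_fix; apply: ray_sum_fixed => //.
by rewrite -xs addrC subrK.
Qed.

(** By density there are periodic points [p] just below and [q] just above [x]; a common iterate
    fixes both, and [interval_period] applies to it. *)
Lemma local_period x T : monotone_system A X T -> X° x ->
  exists p q k, [/\ flt A p x, flt A x q, order_interval A p q `<=` X°, (0 < k)%N
    & forall y, order_interval A p q y -> iter k T y = y].
Proof.
move=> sysT Xx.
have [t t0 tX] := order_interval_small A A_free e x X° e0 (nbhs_interior Xx).
have te i : 0 < t * facet A i e.
  by rewrite mulr_gt0 //; have := e0 i; rewrite facet0.
pose p0 := x - (t / 2) *: e; pose q0 := x + (t / 2) *: e.
have lp : flt A (x - t *: e) p0.
  by move=> i; rewrite /p0 !facetE; have := te i; lra.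
have px : flt A p0 x by move=> i; rewrite /p0 !facetE; have := te i; lra.
have xq : flt A x q0 by move=> i; rewrite /q0 !facetE; have := te i; lra.
have qu : flt A q0 (x + t *: e).
  by move=> i; rewrite /q0 !facetE; have := te i; lra.
have X0 y : flt A (x - t *: e) y -> flt A y (x + t *: e) -> X y.
  by move=> ly yu; apply: nbhs_singleton; apply: tX; split; apply: fltW.
have Xp0 : X p0.
  by apply: X0 => // i; apply: lt_trans (px i) (lt_trans (xq i) (qu i)).
have Xq0 : X q0.
  by apply: X0 => // i; apply: lt_trans (lp i) (lt_trans (px i) (xq i)).
have [p [j [_ [lp' px'] j0 pj]]] := sys_dense _ _ _ sysT p0 _ Xp0
  (filterI (near_flt_r A _ _ lp) (near_flt_l A _ _ px)).
have [q [k [_ [xq' qu'] k0 qk]]] := sys_dense _ _ _ sysT q0 _ Xq0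
  (filterI (near_flt_r A _ _ xq) (near_flt_l A _ _ qu)).
have pqX : order_interval A p q `<=` X°.
  move=> y [py yq]; apply: tX; split; apply: fltW.
    exact: flt_le_trans lp' py.
  exact: fle_lt_trans yq qu'.
have [||||l l0 fix_l] := interval_period p q (iter (j * k) T) _ pqX.
- by move=> i; apply: lt_trans (px' i) (xq' i).
- by apply: sys_iter; rewrite ?muln_gt0 ?j0.
- by rewrite mulnC; apply: iterM_fix.
- exact: iterM_fix.
exists p, q, (l * (j * k))%N; split=> //; first by rewrite !muln_gt0 l0 j0.
by move=> y ypq; rewrite iterM; apply: fix_l.
Qed.

End LocalPeriod.

(** * Spreading the identity across an interval *)

Section Propagation.
Context {R : realType} {n m : nat}.
Implicit Types (A : 'M[R]_(n, m)) (X D : set 'rV[R]_n).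
Implicit Types (T : 'rV[R]_n -> 'rV[R]_n) (e p q x y z v w : 'rV[R]_n).
Implicit Type s : seq 'rV[R]_n.

Definition open_order_interval A p q := [set y | flt A p y /\ flt A y q].

Lemma open_order_interval_nbhs A p q x : open_order_interval A p q x ->
  nbhs x (open_order_interval A p q).
Proof.
by move=> [px xq]; apply: filterI; [apply: near_flt_r|apply: near_flt_l].
Qed.

Definition locally_fixed T := [set x : 'rV[R]_n | nbhs x [set y | T y = y]].

(* For small [t > 0] the point [z + t w] with [w = T (z + v) - z] is fixed and
   lies below [T (z + v)], hence [z + t w] lies below [z + v], and so [w] is a
   multiple of the extremal vector [v]. *)
Lemma fixed_extremal_step A e X D T z v : row_free A -> flt A 0 e ->
  monotone_system A X T -> D `<=` X° ->
  (forall a b, D a -> D b -> fle A (T a) (T b) -> fle A a b) ->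
  nbhs z D -> locally_fixed T z -> extremal A v -> D (z + v) ->
  T (z + v) = z + v.
Proof.
move=> A_free e0 sysT DX reflect zD zfix ext_v Dzv.
have DX' y : D y -> X y by move=> /DX/nbhs_singleton.
have Tz : T z = z := nbhs_singleton zfix.
have Dz : D z := nbhs_singleton zD.
have v0 : fle A 0 v by case: ext_v.
pose w := T (z + v) - z.
have Tzv : T (z + v) = z + w by rewrite /w addrCA subrr addr0.
have w0 : fle A 0 w.
  rewrite fle_sub0 -{1}Tz; apply: (sys_mono _ _ _ sysT); rewrite ?fle_addr //;
    exact: DX'.
have [t1 t10 t1V] := nbhs_segment _ _ z w _ (filterI zD zfix).
pose t := Num.min t1 1.
have t0 : 0 < t by rewrite lt_min t10 ltr01.
have [Dt Tt] : (D `&` [set y | T y = y]) (z + t *: w).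
  by apply: t1V; rewrite ltW // ge_min lexx.
have twv : fle A (t *: w) v.
  rewrite -(fle_sub2r A (- z)) opprK !(addrC _ z); apply: reflect => //.
  rewrite Tt Tzv -fle_subr addrC addKr -[X in fle A _ X]scale1r.
  by apply: fle_scale => //; rewrite ge_min lexx orbT.
have tw0 : fle A 0 (t *: w).
  by rewrite -(scale0r w); apply: fle_scale => //; apply: ltW.
have [s s0 tws] := extremal_segment A A_free v _ ext_v tw0 twv.
have wv : w = (s / t) *: v.
  by rewrite mulrC -scalerA -tws scalerA mulVf ?scale1r ?gt_eqF.
apply: (fixed_of_comparable A e X) => //; first exact: DX.
have shift a b : fle A (z + a) (z + b) = fle A a b.
  by rewrite -fle_subr (addrC z) addrK.
rewrite Tzv /fcomparable !shift.
by have := comparable_scale A 1 (s / t) v v0; rewrite -wv scale1r.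
Qed.

(** The extremal summands are added one at a time; order convexity keeps the partial sums in the
    open interval. *)
Lemma locally_fixed_up A e X T p q z s : row_free A -> flt A 0 e ->
  monotone_system A X T -> open_order_interval A p q `<=` X° ->
  (forall a b, open_order_interval A p q a -> open_order_interval A p q b ->
    fle A (T a) (T b) -> fle A a b) ->
  (forall v, v \in s -> extremal A v) ->
  open_order_interval A p q z -> open_order_interval A p q (z + \sum_(v <- s) v) ->
  locally_fixed T z -> locally_fixed T (z + \sum_(v <- s) v).
Proof.
move=> A_free e0 sysT DX reflect.
elim: s z => [|v s IHs] z ext Dz; first by rewrite big_nil addr0.
rewrite big_cons addrA => Dzs zfix.
have [ext_v ext_s] : extremal A v /\ forall w, w \in s -> extremal A w.
  by split=> [|w ws]; apply: ext; rewrite inE ?eqxx // ws orbT.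
have Dzv : open_order_interval A p q (z + v).
  split; first by apply: flt_le_trans Dz.1 _; rewrite fle_addr; case: ext_v.
  apply: fle_lt_trans Dzs.2; rewrite fle_addr; apply: fle_sum => w ws.
  by have [] := ext_s w ws.
apply: IHs => //.
(* For [y] near [z + v] the point [y - v] is near [z], hence locally fixed, and
   [fixed_extremal_step] from [y - v] fixes [y]. *)
have shift : (fun y => y - v) @ (z + v) --> z.
  rewrite -[X in _ --> X](addrK v).
  exact: (@cvgB _ _ _ (nbhs (z + v)) _ id (cst v) _ _ cvg_id (cvg_cst v)).
have near_z : nbhs z [set y | nbhs y (open_order_interval A p q)
    /\ locally_fixed T y].
  apply: filterI; last exact: nbhs_interior.
  exact: nbhs_interior (open_order_interval_nbhs _ _ _ _ Dz).
have near_zv := @filterI _ _ (nbhs_filter (z + v)) _ _ (shift _ near_z)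
  (open_order_interval_nbhs _ _ _ _ Dzv).
 apply: (@filterS _ (nbhs (z + v)) _ _ _ _ near_zv) => y [/= [yD yfix] Dy].
rewrite -(subrK v y).
by apply: (fixed_extremal_step A e X (open_order_interval A p q)); rewrite ?subrK.
Qed.

Lemma open_order_interval_opp A p q :
  open_order_interval (- A) q p = open_order_interval A p q.
Proof.
by apply/seteqP; split=> y; rewrite /open_order_interval /= !flt_opp => -[].
Qed.

(** Go up from [z] to a common upper bound [w] of [z] and [x] just below [q], then down from [w] to
    [x] by the same argument in the reversed order. *)
Lemma locally_fixed_interval A e X T p q k z x : row_free A -> flt A 0 e ->
  monotone_system A X T -> open_order_interval A p q `<=` X° -> (0 < k)%N ->
  (forall y, open_order_interval A p q y -> iter k T y = y) ->
  open_order_interval A p q z -> open_order_interval A p q x ->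
  locally_fixed T z -> locally_fixed T x.
Proof.
move=> A_free e0 sysT DX k0 perT Dz Dx zfix.
(* On the open interval the iterate of order [k - 1] is a monotone left inverse of [T]. *)
have reflect a b : open_order_interval A p q a -> open_order_interval A p q b ->
    fle A (T a) (T b) -> fle A a b.
  move=> Da Db; rewrite -{2}(perT a Da) -{2}(perT b Db); case: k k0 {perT} => // k _.
  have X_ y : open_order_interval A p q y -> X y by move=> /DX/nbhs_singleton.
  rewrite !iterSr; apply: (sys_iter_mono _ _ _ _ _ _ sysT);
    apply: (sys_self _ _ _ sysT); exact: X_.
have [t t0 tq] := nbhs_segment _ _ q (- e) _
  (filterI (near_flt_r A _ _ Dz.2) (near_flt_r A _ _ Dx.2)).
set w := q + t *: - e in tq.
have [zw xw] : flt A z w /\ flt A x w by apply: tq; rewrite lexx ltW.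
have wq : flt A w q.
  move=> i; rewrite /w !facetE mulrN gtrDl oppr_lt0 mulr_gt0 //.
  by have := e0 i; rewrite facet0.
have Dw : open_order_interval A p q w.
  by split=> //; apply: flt_le_trans Dz.1 (fltW _ _ _ zw).
have wfix : locally_fixed T w.
  have [|s [_ ext ws]] := extremal_sum A A_free (w - z).
    by rewrite fle_sub0; apply: fltW.
  have wE : w = z + \sum_(v <- s) v by rewrite -ws addrCA subrr addr0.
  by rewrite wE; apply: (locally_fixed_up A e X T p q); rewrite -?wE.
have [|s [_ ext xs]] := extremal_sum (- A) (row_free_opp _ A_free) (x - w).
  by rewrite fle_sub0 fle_opp; apply: fltW.
have xE : x = w + \sum_(v <- s) v by rewrite -xs addrCA subrr addr0.
rewrite xE; apply: (locally_fixed_up (- A) (- e) X T q p);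
  rewrite -?xE ?open_order_interval_opp //.
- exact: row_free_opp.
- by rewrite flt_opp => i; have := e0 i; rewrite !facetE oppr_lt0.
- exact: sys_opp.
- by move=> a b Da Db; rewrite !fle_opp; apply: reflect.
Qed.

End Propagation.

(** * From local to global period *)

Section GlobalPeriod.
Context {R : realType} {n m : nat} (A : 'M[R]_(n, m)) (e : 'rV[R]_n).
Context (X : set 'rV[R]_n).
Hypotheses (A_free : row_free A) (e0 : flt A 0 e).
Implicit Types (T : 'rV[R]_n -> 'rV[R]_n) (x y z : 'rV[R]_n).

(** An open interval around [x] on which [T] has finite period meets the locally fixed set, and the
    identity spreads from there to [x]. *)
Lemma locally_fixed_closed T x : monotone_system A X T -> X° x ->
  closure (X° `&` locally_fixed T) x -> locally_fixed T x.
Proof.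
move=> sysT Xx xcl.
have [p [q [k [px xq pqX k0 per]]]] := local_period A A_free e e0 X x T sysT Xx.
have [z [[_ zfix] zpq]] := xcl _ (open_order_interval_nbhs A p q x (conj px xq)).
apply: (locally_fixed_interval A e X T p q k z) => //.
  by move=> y [py yq]; apply: pqX; split; apply: fltW.
by move=> y [py yq]; apply: per; split; apply: fltW.
Qed.

Lemma fixed_of_dense D T x : monotone_system A X T -> D `<=` X ->
  (forall y, D y -> T y = y) -> X x -> closure D x -> T x = x.
Proof.
move=> sysT DX DT Xx xcl; apply: (@norm_hausdorff _ 'rV[R]_n) => V W TxV xW.
have [y [Dy [Vy Wy]]] := xcl _ (filterI (sys_cont _ _ _ sysT x V Xx TxV) xW).
by exists y; split=> //; rewrite -(DT y Dy); apply: Vy; apply: DX.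
Qed.

Lemma global_period T : monotone_system A X T -> X !=set0 -> connected X° ->
  X `<=` closure X° -> exists2 k, (0 < k)%N & forall x, X x -> iter k T x = x.
Proof.
move=> sysT [x1 Xx1] Xconn Xcl.
have [x0 [Xx0 _]] := Xcl _ Xx1 setT filterT.
have [p [q [k [px xq pqX k0 per]]]] := local_period A A_free e e0 X x0 T sysT Xx0.
have sysk : monotone_system A X (iter k T) by apply: sys_iter.
(* [B] is nonempty, open and relatively closed in the connected set [X°]. *)
pose B := X° `&` locally_fixed (iter k T).
have BX : B = X°.
  apply: Xconn.
  - exists x0; split=> //.
    have := open_order_interval_nbhs A p q x0 (conj px xq).
    apply: (@filterS _ (nbhs x0)) => y [py yq].
    by apply: per; split; apply: fltW.
  - exists ([set y | iter k T y = y]°) => //; exact: open_interior.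
  exists (closure B); first exact: closed_closure.
  apply/seteqP; split=> [y By|y [Xy By]].
    by split; [case: By|apply: subset_closure].
  by split=> //; apply: locally_fixed_closed.
exists k => // x Xx.
apply: (fixed_of_dense X° (iter k T)) => //; last exact: Xcl.
- by move=> y /nbhs_singleton.
- by rewrite -BX => y [_ /nbhs_singleton].
Qed.

End GlobalPeriod.

(** * Facet presentation of the cone, and the theorem *)

(** Invariance under scaling makes the halfspaces homogeneous; pointedness gives [row_free A], and
    an interior point serves as [e]. *)
Lemma polyhedral_cone_facets (R : realType) (n : nat) (K : set 'rV[R]_n) :
  solid_order_cone K -> polyhedron K ->
  exists m (A : 'M[R]_(n, m)) e,
    [/\ row_free A, flt A 0 e & forall x, K x <-> fle A 0 x].
Proof.
move=> [_ [_ K_scale] [e Ke] K_pointed] [m [H [H_half KH]]].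
have /choice[f fP] : forall i, exists ab : 'rV[R]_n * R, ab.1 != 0 /\
    H i = [set x | \sum_(j < n) ab.1 0 j * x 0 j <= ab.2].
  by move=> i; have [a [b ab]] := H_half i; exists (a, b).
pose A : 'M[R]_(n, m) := \matrix_(j, i) - (f i).1 0 j.
have facetA i x : facet A i x = - \sum_(j < n) (f i).1 0 j * x 0 j.
  rewrite /facet mxE -sumrN; apply: eq_bigr => j _.
  by rewrite mxE mulrN mulrC.
have K0 : K 0 by rewrite -(scale0r e); apply: K_scale (nbhs_singleton Ke).
have K_half i x : K x -> - facet A i x <= (f i).2.
  by rewrite KH facetA opprK => /(_ i I); rewrite (fP i).2.
have KA x : K x <-> fle A 0 x.
  split=> [Kx|/fle0P x0].
    apply/fle0P => i; rewrite leNgt; apply/negP => xi.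
    have b0 : 0 <= (f i).2 by have := K_half i _ K0; rewrite facet0 oppr0.
    (* With this [t], the point [t *: x] of [K] would exceed the bound [(f i).2] by one. *)
    pose t := ((f i).2 + 1) / - facet A i x.
    have t0 : 0 <= t by rewrite divr_ge0 ?addr_ge0 ?oppr_ge0 // ltW.
    have := K_half i _ (K_scale t x t0 Kx).
    rewrite facetZ -mulrN divfK ?oppr_eq0 ?lt_eqF //; lra.
  rewrite KH => i _; rewrite (fP i).2 /=.
  have := x0 i; rewrite facetA oppr_ge0 => /le_trans; apply.
  by have := K_half i _ K0; rewrite facet0 oppr0.
exists m, A, e; split=> //; last first.
  move=> i; rewrite facet0.
  (* Moving from [e] along the outward normal stays in [K] for a while and strictly decreases facet
     [i], which was therefore positive. *)
  have [t t0 tK] := nbhs_segment _ _ e (f i).1 _ Ke.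
  have /KA/fle0P/(_ i) : K (e + t *: (f i).1) by apply: tK; rewrite lexx ltW.
  have a_lt0 : t * facet A i (f i).1 < 0.
    rewrite pmulr_rlt0 // facetA oppr_lt0 lt_neqAle eq_sym.
    rewrite sumr_ge0 => [|j _]; last by rewrite -expr2 sqr_ge0.
    rewrite andbT psumr_eq0 => [|j _]; last by rewrite -expr2 sqr_ge0.
    apply: contra (fP i).1 => /allP a0; apply/eqP/rowP => j.
    by have := a0 j (mem_index_enum j); rewrite mulf_eq0 orbb mxE => /eqP.
  by rewrite !facetE; lra.
apply: inj_row_free => v vA0; apply: contrapT => /eqP v0.
(* A nonzero [v] killed by [A] spans a line inside [K]. *)
apply: K_pointed; exists 0, v; split=> // _ [t _ <-].
by apply/KA/fle0P => i; rewrite add0r facetZ /facet vA0 mxE mulr0.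
Qed.

Theorem theorem1 (R : realType) (n : nat) (K X : set 'rV[R]_n)
  (T : 'rV[R]_n -> 'rV[R]_n)
  (K_cone : solid_order_cone K)
  (K_poly : polyhedron K)
  (X_neq0 : X !=set0)
  (X_int_connected : connected X°)
  (X_int_dense : dense_in X° X)
  (T_self : set_fun X X T)
  (T_inj : set_inj X T)
  (T_cont : {within X, continuous T})
  (T_mono : cone_monotone K X T)
  (T_dense : dense_in (periodic_points X T) X) :
  exists k : nat, (0 < k)%N /\ forall x : 'rV[R]_n, X x -> iter k T x = x.
Proof.
have [m [A [e [A_free e0 KA]]]] := polyhedral_cone_facets R n K K_cone K_poly.
suff sysT : monotone_system A X T.
  have [k k0 perT] := global_period A e X A_free e0 T sysT X_neq0 X_int_connected
    X_int_dense.2.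
  by exists k.
split=> //.
- by move=> x y Xx Xy; apply: T_inj; rewrite inE.
- by move=> x V Xx; move/subspace_continuousP: T_cont => /(_ x Xx); apply.
- move=> x y Xx Xy; rewrite -fle_sub0 => /KA xy; rewrite -fle_sub0.
  by apply/KA; apply: (T_mono y x).
move=> x V Xx xV; have [y [[k k0 [Xy yk]] Vy]] := T_dense.2 x Xx V xV.
by exists y, k.
Qed.
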